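(* The competitive ratio of every Move-To-Front-Every-Other-Access algorithm (for any choice of initial bits) is exactly $2.5$ (full cost model): $2.5$ is the infimum of the constants $c$ for which there exists $b$ with $A(\sigma)\le c\cdot\mathrm{OPT}(\sigma)+b$ for all request sequences $\sigma$.
   Context: Static list update: a list of $l$ distinct items in some initial order; serving a request to the item at position $i$ (from the front) costs $i$ (full cost model); the accessed item may be moved closer to the front for free (free exchange); two adjacent items may be swapped at cost $1$ (paid exchange). $A(\sigma)$ is the total cost of algorithm $A$ and $\mathrm{OPT}(\sigma)$ the minimum cost of any offline algorithm from the same initial list. The constant $b$ may depend on the list length but not on $\sigma$. A Move-To-Front-Every-Other-Access (MTF2) algorithm maintains one bit per item, with arbitrary initial values; on each request to an item $z$ it flips the bit of $z$, and if the bit becomes $0$ it moves $z$ to the front (free exchange), otherwise it leaves the list unchanged; it makes no paid exchanges. *)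

(* Defs.v *)
From mathcomp Require Import all_boot.
From Stdlib Require Import Reals ClassicalEpsilon.

Set Implicit Arguments.
Unset Strict Implicit.
Unset Printing Implicit Defensive.

(* Items of a list of length l are the naturals 0, ..., l-1; a list state is
   a sequence L with perm_eq L (iota 0 l).  Positions are 1-based in costs:
   accessing the item at 0-based index i costs i+1 (full cost model). *)

Fixpoint mtf2_cost (L : seq nat) (bits : nat -> bool) (s : seq nat) : nat :=
  match s with
  | [::] => 0
  | z :: s' =>
      let nb := ~~ bits z in
      let bits' := fun x => if x == z then nb else bits x in
      let L' := if nb then L else z :: rem z L in
      (index z L).+1 + mtf2_cost L' bits' s'
  end.

(** Paid exchange of the adjacent items at 0-based positions i and i+1
    (no effect, but still cost 1, if i+1 is out of range). *)
Definition swap_adj (L : seq nat) (i : nat) : seq nat :=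
  if i.+1 < size L then
    take i L ++ [:: nth 0 L i.+1; nth 0 L i] ++ drop i.+2 L
  else L.

(** Free exchanges: move the accessed item z forward to 0-based position
    q (capped at its current position, so it only moves closer to the front). *)
Definition move_forward (L : seq nat) (z q : nat) : seq nat :=
  let q' := minn q (index z L) in
  let L1 := rem z L in
  take q' L1 ++ z :: drop q' L1.

Fixpoint off_cost (L : seq nat) (sched : seq (seq nat * nat)) (s : seq nat) : nat :=
  match s with
  | [::] => 0
  | z :: s' =>
      let act := head ([::], 0) sched in
      let L' := foldl swap_adj L act.1 in
      let L'' := move_forward L' z act.2 in
      size act.1 + (index z L').+1 + off_cost L'' (behead sched) s'
  end.

Definition off_achievable (L : seq nat) (s : seq nat) : pred nat :=
  fun n => if excluded_middle_informative
                (exists sched, off_cost L sched s = n) then true else false.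

Lemma off_achievable_ex (L : seq nat) (s : seq nat) :
  exists n, off_achievable L s n.
Proof.
exists (off_cost L [::] s); rewrite /off_achievable.
case: excluded_middle_informative => // H; exfalso; apply: H; by exists [::].
Qed.

Definition OPT (L : seq nat) (s : seq nat) : nat := ex_minn (off_achievable_ex L s).

(** The set of constants c for which MTF2 (with initial-bit assignment
    beta : list length -> initial list -> item -> bit) is c-competitive:
    for every list length l there is b (depending on l only) such that
    A(sigma) <= c * OPT(sigma) + b for every initial list and request sequence. *)
Definition mtf2_competitive (beta : nat -> seq nat -> nat -> bool) (c : R) : Prop :=
  forall l : nat, exists b : R,
    forall (L0 : seq nat) (s : seq nat),
      perm_eq L0 (iota 0 l) -> all (fun x => x < l) s ->
      (INR (mtf2_cost L0 (beta l L0) s) <= c * INR (OPT L0 s) + b)%R.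

(* Main.v *)
Require Import Defs.
From mathcomp Require Import all_boot zify.
From Stdlib Require Import Reals Lra.

Set Implicit Arguments.
Unset Strict Implicit.
Unset Printing Implicit Defensive.

(** Upper bound.  Let the potential of a pair of items {x, y}, with x before y
    in the list of MTF2, be bit(y) if the offline list orders x, y in the same
    way, and 4 + bit(x) - 2 bit(y) otherwise.  Summed over all pairs, an access
    changes the potential by at most 5 times the offline cost minus twice the
    cost of MTF2, both counted without the constant 1 per access, and a paid
    exchange increases it by at most 5.

    Lower bound.  Requesting once every item whose bit is 0 moves nothing and
    sets all bits to 1.  From a common list e_1 ... e_l with all bits 1, request
    e_1, ..., e_l and then e_1 three times, ..., e_l three times.  MTF2 reverses
    its list in the first pass, has bits 0, and then pays l, l, 1 for the three
    requests to each e_i, so about l^2/2 + 2 l^2 in total.  The offline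
    algorithm stays put in the first pass and moves each e_i to the front in the
    second one, paying about l^2/2 + l^2/2.  Both lists end up as e_l ... e_1
    with all bits 1, so the pattern can be repeated. *)

(** * Pairwise order in a list, and free exchanges *)

Definition bef (L : seq nat) (x y : nat) : bool := index x L < index y L.

Lemma index_cat_cons (p r : seq nat) (x z : nat) : x != z ->
  index x (p ++ z :: r) = if x \in p then index x p else size p + (index x r).+1.
Proof. by move=> xz; rewrite index_cat /= eq_sym (negPf xz). Qed.

Lemma bef_insert (p r : seq nat) (x y z : nat) : x != z -> y != z ->
  bef (p ++ z :: r) x y = bef (p ++ r) x y.
Proof.
move=> xz yz; rewrite /bef !index_cat_cons // !index_cat.
case: (boolP (x \in p)); case: (boolP (y \in p)); rewrite -?index_mem /=; lia.
Qed.

(** Membership of [x] suffices: equal indices would put [y] in [L] too, and then force [x = y]. *)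
Lemma bef_asym (L : seq nat) (x y : nat) : x \in L -> x != y ->
  bef L x y = ~~ bef L y x.
Proof.
move=> xL xy; have : index x L != index y L.
  apply: contraNneq xy => e; apply/eqP/(index_inj x xL) => //.
  by rewrite -index_mem -e index_mem.
by rewrite /bef; lia.
Qed.

Lemma befxx (L : seq nat) (x : nat) : bef L x x = false.
Proof. exact: ltnn. Qed.

Lemma rem_cat_self (p r : seq nat) (z : nat) : z \notin p ->
  rem z (p ++ z :: r) = p ++ r.
Proof.
elim: p => [_|a p IH] /=; first by rewrite eqxx.
by rewrite inE negb_or eq_sym => /andP[/negPf-> /IH->].
Qed.

Lemma split_first (L : seq nat) (z : nat) : z \in L ->
  exists p r, L = p ++ z :: r /\ z \notin p.
Proof.
move=> zL; exists (take (index z L) L), (drop (index z L).+1 L); split.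
  by rewrite -{1}(cat_take_drop (index z L) L) (drop_nth z) ?index_mem // nth_index.
by rewrite in_take_leq ?index_size // ltnn.
Qed.

Lemma move_forward_cat (L : seq nat) (z q : nat) : z \in L ->
  exists p1 p2 r, [/\ L = p1 ++ p2 ++ z :: r, z \notin p1, z \notin p2 &
    move_forward L z q = p1 ++ z :: p2 ++ r].
Proof.
case/split_first=> p [r [-> zp]].
rewrite /move_forward index_pivot // rem_cat_self //.
set k := minn q (size p); have kp : k <= size p by rewrite geq_minr.
exists (take k p), (drop k p), r.
have := zp; rewrite -{1}(cat_take_drop k p) mem_cat negb_or => /andP[z1 z2].
split=> //; first by rewrite catA cat_take_drop.
rewrite takel_cat // drop_cat; case: ltnP => // le.
have -> : k = size p by apply/eqP; rewrite eqn_leq kp.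
by rewrite subnn drop0 drop_size.
Qed.

Lemma perm_move_forward (L : seq nat) (z q : nat) : z \in L ->
  perm_eq (move_forward L z q) L.
Proof.
case/(move_forward_cat q)=> p1 [p2 [r [-> _ _ ->]]].
rewrite perm_cat2l perm_sym -cat1s -[z :: _]cat1s.
by rewrite perm_catCA.
Qed.

Lemma bef_move_forward (L : seq nat) (z q x y : nat) : z \in L ->
  x != z -> y != z -> bef (move_forward L z q) x y = bef L x y.
Proof.
case/(move_forward_cat q)=> p1 [p2 [r [-> _ _ ->]]] xz yz.
by rewrite bef_insert // [in RHS]catA bef_insert // catA.
Qed.

Lemma bef_move_forward_moved (L : seq nat) (z q x : nat) : z \in L ->
  bef (move_forward L z q) x z -> bef L x z.
Proof.
case/(move_forward_cat q)=> p1 [p2 [r [-> z1 z2 ->]]].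
rewrite /bef !index_cat (negPf z1) (negPf z2) /= eqxx.
by have := index_mem x p1; case: (x \in p1); lia.
Qed.

Lemma move_front (L : seq nat) (z : nat) : move_forward L z 0 = z :: rem z L.
Proof. by rewrite /move_forward min0n take0 drop0. Qed.

(** * Access costs as sums over pairs; the potential *)

Lemma index_sum_bef (l : nat) (L : seq nat) (z : nat) :
  perm_eq L (iota 0 l) -> z < l -> index z L = \sum_(x < l) bef L x z.
Proof.
move=> pL zl.
have uL : uniq L by rewrite (perm_uniq pL) iota_uniq.
have zL : z \in L by rewrite (perm_mem pL) mem_iota.
rewrite -(big_mkord xpredT (fun x => (bef L x z : nat))) /index_iota subn0.
rewrite -(perm_big _ pL) /= (big_nth z) big_nat.
(* The item at position [i] precedes [z] exactly when [i < index z L], so the sum counts these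
   positions. *)
under eq_bigr => i /andP[_ iL] do rewrite /bef index_uniq //.
rewrite -big_nat -(big_mkcond (fun i => i < index z L) (fun=> 1)) /=.
rewrite -(@big_nat_widen _ _ _ 0 (index z L) (size L) xpredT (fun=> 1)) ?index_size //.
by rewrite sum_nat_const_nat subn0 muln1.
Qed.

(* Here p and q say that x is before y in the MTF2 and in the offline list. *)
Definition psi_ord (p q bitx bity : bool) : nat :=
  if p then if q then (bity : nat) else 4 + bitx - bity.*2 else 0.

Definition psi (L O : seq nat) (b : nat -> bool) (x y : nat) : nat :=
  psi_ord (bef L x y) (bef O x y) (b x) (b y) +
  psi_ord (bef L y x) (bef O y x) (b y) (b x).

(* Each unordered pair is counted twice, which doubles the constants: 4 and 10
   instead of 2 and 5. *)
Definition Psi (l : nat) (L O : seq nat) (b : nat -> bool) : nat :=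
  \sum_(x < l) \sum_(y < l) psi L O b x y.

Lemma psi_sym L O b x y : psi L O b x y = psi L O b y x.
Proof. exact: addnC. Qed.

Lemma psixx L O b x : psi L O b x x = 0.
Proof. by rewrite /psi befxx. Qed.

(** At most one of the two summands is nonzero, since [bef L] cannot hold both ways; the largest
    value is [4 + 1 - 0]. *)
Lemma psi_le5 L O b x y : psi L O b x y <= 5.
Proof.
rewrite /psi /bef.
by case: ltngtP => _ /=; case: (_ < _); case: (_ < _); case: (b x); case: (b y).
Qed.

Lemma Psi_le l L O b : Psi l L O b <= 5 * l * l.
Proof.
rewrite /Psi; apply: (@leq_trans (\sum_(x < l) \sum_(y < l) 5)).
  by apply: leq_sum => x _; apply: leq_sum => y _; exact: psi_le5.
by rewrite !sum_nat_const !card_ord; lia.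
Qed.

Lemma sum_delta (l : nat) (z : 'I_l) (c : nat) : \sum_(y < l) (y == z) * c = c.
Proof. by rewrite (bigD1 z) //= eqxx mul1n big1 ?addn0 // => i /negPf->. Qed.

(** This gives the access cost the shape of [Psi], so that the two can be compared term by term. The
    factor 2 comes from ordered pairs. *)
Lemma sum_access (l : nat) (L : seq nat) (z : 'I_l) : perm_eq L (iota 0 l) ->
  \sum_(x < l) \sum_(y < l) ((y == z) * bef L x z + (x == z) * bef L y z)
    = 2 * index (val z) L.
Proof.
move=> pL; under eq_bigr => x _ do rewrite big_split sum_delta -big_distrr.
by rewrite big_split sum_delta /= -(index_sum_bef pL) //; lia.
Qed.

Lemma sum_swap (l : nat) (u v : 'I_l) :
  \sum_(x < l) \sum_(y < l) ((y == v) * (x == u) + (y == u) * (x == v)) = 2.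
Proof.
under eq_bigr => x _ do rewrite big_split !sum_delta.
have d w : \sum_(x < l) (x == w :> 'I_l) = 1.
  by rewrite -[RHS](sum_delta w); apply: eq_bigr => x _; rewrite muln1.
by rewrite big_split !d.
Qed.

(** * The change of the potential at one access *)

Definition flip (b : nat -> bool) (z x : nat) : bool :=
  if x == z then ~~ b z else b x.

Definition mtf2_list (L : seq nat) (b : nat -> bool) (z : nat) : seq nat :=
  if ~~ b z then L else z :: rem z L.

Lemma mtf2_cost_cons L b z s :
  mtf2_cost L b (z :: s) = (index z L).+1 + mtf2_cost (mtf2_list L b z) (flip b z) s.
Proof. by []. Qed.

Lemma mtf2_list_stay L b z : b z = false -> mtf2_list L b z = L.
Proof. by rewrite /mtf2_list => ->. Qed.

Lemma mtf2_list_front L (b : nat -> bool) z : b z -> mtf2_list L b z = z :: rem z L.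
Proof. by rewrite /mtf2_list => ->. Qed.

(** If [x] precedes [z] in [L] but not in [O], two successive accesses to [z] take the potential
    through [4 + b x], [2 + b x], [b x]: each drop of 2 pays for MTF2. If [x] precedes [z] in both
    lists, the offline 5 pays for MTF2 and for a new disagreement. *)
Lemma psi_access_last (L O : seq nat) (b : nat -> bool) (x z q : nat) :
  x != z -> z \in L -> z \in O ->
  2 * bef L x z + psi (mtf2_list L b z) (move_forward O z q) (flip b z) x z
    <= 5 * bef O x z + psi L O b x z.
Proof.
move=> xz zL zO.
have pO := perm_move_forward q zO.
rewrite /psi (bef_asym zL) 1?eq_sym // (bef_asym zO) 1?eq_sym //.
rewrite (@bef_asym (move_forward O z q) z x) ?(perm_mem pO) 1?eq_sym //.
have -> : flip b z x = b x by rewrite /flip (negPf xz).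
have -> : flip b z z = ~~ b z by rewrite /flip eqxx.
have -> : bef (mtf2_list L b z) x z = b z && false || ~~ b z && bef L x z.
  rewrite /mtf2_list; case: (b z) => //=; by rewrite /bef /= eqxx ltn0.
have -> : bef (mtf2_list L b z) z x = b z || ~~ bef L x z.
  rewrite /mtf2_list; case: (b z) => /=; last by rewrite (bef_asym zL) // eq_sym.
  by rewrite /bef /= eqxx (eq_sym z) (negPf xz).
(* This rules out the cases in which the offline move would put [x] in front of [z]; all others are
   computed. *)
have := @bef_move_forward_moved O z q x zO.
case: (bef (move_forward O z q) x z); case: (bef O x z); case: (bef L x z);
  case: (b x); case: (b z) => // H; by have := H isT.
Qed.

Lemma Psi_access (l : nat) (L O : seq nat) (b : nat -> bool) (z q : nat) :
  perm_eq L (iota 0 l) -> perm_eq O (iota 0 l) -> z < l ->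
  4 * index z L + Psi l (mtf2_list L b z) (move_forward O z q) (flip b z)
    <= 10 * index z O + Psi l L O b.
Proof.
move=> pL pO zl.
have mL x : x < l -> x \in L by rewrite (perm_mem pL) mem_iota.
have mO x : x < l -> x \in O by rewrite (perm_mem pO) mem_iota.
pose z' := Ordinal zl.
(* The outer factors 2 and 5 are the constants of a single pair; the inner [2 * index] is expanded
   by [sum_access]. *)
have -> : 4 * index z L = 2 * (2 * index (val z') L) by rewrite /=; lia.
have -> : 10 * index z O = 5 * (2 * index (val z') O) by rewrite /=; lia.
rewrite -!sum_access // !big_distrr /= /Psi -!big_split.
apply: leq_sum => x _; rewrite !big_distrr -!big_split; apply: leq_sum => y _.
rewrite -!val_eqE /=.
case: (eqVneq (val x) z) => [xz|xz]; case: (eqVneq (val y) z) => [yz|yz].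
- by rewrite xz yz !befxx !psixx.
- have := psi_access_last b q yz (mL _ zl) (mO _ zl).
  by rewrite xz !(psi_sym _ _ _ z y) /= !mul0n !mul1n !add0n.
- have := psi_access_last b q xz (mL _ zl) (mO _ zl).
  by rewrite yz /= !mul0n !mul1n !addn0.
rewrite !mul0n !muln0 !add0n /psi !bef_move_forward ?mO //.
rewrite /flip (negPf xz) (negPf yz).
have e u v : u != z -> v != z -> bef (mtf2_list L b z) u v = bef L u v.
  by rewrite /mtf2_list; case: (~~ b z) => // uz vz; rewrite -move_front bef_move_forward ?mL.
by rewrite !e.
Qed.

(** * Paid exchanges and the amortized bound *)

Lemma swap_adj_cat (O : seq nat) (i : nat) : uniq O -> i.+1 < size O ->
  exists u v p r, [/\ O = p ++ [:: u, v & r], swap_adj O i = p ++ [:: v, u & r]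
    & u != v].
Proof.
move=> uO iO.
exists (nth 0 O i), (nth 0 O i.+1), (take i O), (drop i.+2 O); split.
- by rewrite -!drop_nth ?cat_take_drop // ltnW.
- by rewrite /swap_adj iO.
- by rewrite nth_uniq ?(ltnW iO) // neq_ltn leqnn.
Qed.

Lemma perm_swap_adj (O : seq nat) (i : nat) : uniq O -> perm_eq (swap_adj O i) O.
Proof.
move=> uO; case: (ltnP i.+1 (size O)) => iO; last first.
  by rewrite /swap_adj ltnNge iO.
have [u [v [p [r [-> -> _]]]]] := swap_adj_cat uO iO.
by rewrite perm_cat2l (perm_catCA [:: v] [:: u]).
Qed.

Lemma Psi_swap (l : nat) (L O : seq nat) (b : nat -> bool) (i : nat) :
  perm_eq O (iota 0 l) -> Psi l L (swap_adj O i) b <= 10 + Psi l L O b.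
Proof.
move=> pO; have uO : uniq O by rewrite (perm_uniq pO) iota_uniq.
case: (ltnP i.+1 (size O)) => iO; last first.
  by rewrite /swap_adj ltnNge iO /= leq_addl.
have [u [v [p [r [eO eO' uv]]]]] := swap_adj_cat uO iO.
have ml x : x \in O -> x < l by rewrite (perm_mem pO) mem_iota.
have ul : u < l by apply: ml; rewrite eO mem_cat !inE eqxx orbT.
have vl : v < l by apply: ml; rewrite eO mem_cat !inE eqxx !orbT.
have -> : 10 = 5 * \sum_(x < l) \sum_(y < l)
    ((y == Ordinal vl) * (x == Ordinal ul) + (y == Ordinal ul) * (x == Ordinal vl)).
  by rewrite sum_swap.
rewrite !big_distrr /= /Psi -!big_split.
apply: leq_sum => x _; rewrite !big_distrr -!big_split; apply: leq_sum => y _.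
rewrite -!val_eqE /=; move: (val x) (val y) => {}x {}y.
(* Deleting [u] from the list before and after the swap leaves the same list, and likewise for [v];
   hence only the pair [u], [v] changes its order. *)
have nu s t : s != u -> t != u -> bef (swap_adj O i) s t = bef O s t.
  by move=> su tu; rewrite eO' eO -[v :: u :: r]cat1s catA !(@bef_insert _ _ _ _ u) // -catA.
have nv s t : s != v -> t != v -> bef (swap_adj O i) s t = bef O s t.
  by move=> sv tv; rewrite eO' eO -[u :: v :: r]cat1s catA !(@bef_insert _ _ _ _ v) // -catA.
have := psi_le5 L (swap_adj O i) b x y.
case: (eqVneq x u) => [xu|xu]; case: (eqVneq y v) => [yv|yv] le5 /=.
- by apply: leq_trans le5 _; rewrite muln1 mulnDr -addnA leq_addr.
- by rewrite /psi !nv ?leq_addl // xu.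
- case: (eqVneq x v) => [xv|xv]; last by rewrite /psi !nu ?leq_addl // yv eq_sym.
  by rewrite xv yv !psixx.
case: (eqVneq y u) => [yu|yu]; last by rewrite /psi !nu ?leq_addl.
case: (eqVneq x v) => [xv|xv]; first exact: leq_trans le5 (leq_addr _ _).
by rewrite /psi !nv ?leq_addl.
Qed.

Lemma perm_foldl_swap (acts : seq nat) (O : seq nat) : uniq O ->
  perm_eq (foldl swap_adj O acts) O.
Proof.
elim: acts O => //= i acts IH O uO; have p := perm_swap_adj i uO.
by apply: (perm_trans (IH _ _) p); rewrite (perm_uniq p).
Qed.

Lemma Psi_foldl_swap (l : nat) (L O : seq nat) (b : nat -> bool) (acts : seq nat) :
  perm_eq O (iota 0 l) ->
  Psi l L (foldl swap_adj O acts) b <= 10 * size acts + Psi l L O b.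
Proof.
elim: acts O => //= i acts IH O pO.
have uO : uniq O by rewrite (perm_uniq pO) iota_uniq.
have := IH _ (perm_trans (perm_swap_adj i uO) pO).
by have := Psi_swap L b i pO; lia.
Qed.

(** The potential differences telescope. The constant 1 per access contributes 4 on the left and 10
    on the right, so the full cost model does no harm. *)
Lemma mtf2_cost_le_off_cost (l : nat) (s L O : seq nat) (b : nat -> bool) sched :
  perm_eq L (iota 0 l) -> perm_eq O (iota 0 l) -> all (fun x => x < l) s ->
  4 * mtf2_cost L b s <= 10 * off_cost O sched s + Psi l L O b.
Proof.
elim: s L O b sched => [|z s IH] L O b sched pL pO; first by [].
case/andP=> zl als; rewrite mtf2_cost_cons [off_cost _ _ _]/=.
set acts := (head _ sched).1; set q := (head _ sched).2.
set O1 := foldl swap_adj O acts.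
have uO : uniq O by rewrite (perm_uniq pO) iota_uniq.
have pO1 : perm_eq O1 (iota 0 l) by apply: perm_trans pO; exact: perm_foldl_swap.
have zO1 : z \in O1 by rewrite (perm_mem pO1) mem_iota.
have zL : z \in L by rewrite (perm_mem pL) mem_iota.
have pL' : perm_eq (mtf2_list L b z) (iota 0 l).
  rewrite /mtf2_list; case: ifP => // _; apply: perm_trans pL.
  by rewrite -move_front perm_move_forward.
have pO2 := perm_trans (perm_move_forward q zO1) pO1.
have := IH _ _ (flip b z) (behead sched) pL' pO2 als.
have := Psi_access b q pL pO1 zl.
have := Psi_foldl_swap L b acts pO.
by rewrite -/O1; lia.
Qed.

(** * OPT as a minimum over schedules *)

Lemma OPT_achieved (L s : seq nat) : exists sched, off_cost L sched s = OPT L s.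
Proof.
rewrite /OPT; case: ex_minnP => n; rewrite /off_achievable.
by case: ClassicalEpsilon.excluded_middle_informative.
Qed.

Lemma OPT_le (L s : seq nat) sched : OPT L s <= off_cost L sched s.
Proof.
rewrite /OPT; case: ex_minnP => n _; apply; rewrite /off_achievable.
case: ClassicalEpsilon.excluded_middle_informative => // H.
by exfalso; apply: H; exists sched.
Qed.

(** * The cost of MTF2 on the periodic requests *)

Lemma double_sumn_iota (k n : nat) : 2 * sumn (iota k.+1 n) = n * (2 * k + n + 1).
Proof. by elim: n k => //= n IH k; rewrite mulnDr IH; nia. Qed.

Definition thrice (e : seq nat) : seq nat := flatten [seq [:: z; z; z] | z <- e].

(** Here [p] is the part already served, lying reversed at the front. The next item stands right
    behind it and has bit 1, so it moves to the front. The final bits are specified only on listed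
    items, hence the existential. *)
Lemma mtf2_pass_once (q p : seq nat) (b : nat -> bool) (s : seq nat) :
  uniq (p ++ q) -> {in p, forall x, b x = false} -> {in q, forall x, b x} ->
  exists2 b' : nat -> bool, {in p ++ q, forall x, b' x = false} &
    mtf2_cost (rev p ++ q) b (q ++ s) =
    sumn (iota (size p).+1 (size q)) + mtf2_cost (rev (p ++ q)) b' s.
Proof.
elim: q p b => [|z q IH] p b u bp bq.
  by exists b => /=; rewrite !cats0.
have [zp zq] : z \notin p /\ z \notin q.
  move: u; rewrite cat_uniq /= negb_or => /and3P[_ /andP[-> _] /andP[-> _]] //.
rewrite -cat_rcons in u.
have [|x|b' b'F e] := IH (rcons p z) (flip b z) u.
- move=> x; rewrite mem_rcons inE /flip; case: eqP => [_ _|_ /bp//].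
  by rewrite bq ?mem_head.
- by move=> xq; rewrite /flip; case: eqP xq zq => [-> ->//|_ xq _]; rewrite bq // inE xq orbT.
exists b'; first by rewrite -cat_rcons.
rewrite cat_cons mtf2_cost_cons mtf2_list_front ?bq ?mem_head //.
rewrite index_pivot ?mem_rev // rem_cat_self ?mem_rev // size_rev -cat_rcons.
by move: e; rewrite rev_rcons size_rcons /= => ->; lia.
Qed.

(** The next item is last and has bit 0: its first request leaves it there, the second brings it to
    the front, the third finds it there and resets its bit to 1. *)
Lemma mtf2_pass_thrice (q p : seq nat) (b : nat -> bool) (s : seq nat) :
  uniq (p ++ q) -> {in p, forall x, b x} -> {in q, forall x, b x = false} ->
  exists2 b' : nat -> bool, {in p ++ q, forall x, b' x} &
    mtf2_cost (rev p ++ rev q) b (thrice q ++ s) =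
    size q * (2 * size (p ++ q) + 1) + mtf2_cost (rev (p ++ q)) b' s.
Proof.
elim: q p b => [|z q IH] p b u bp bq.
  by exists b => /=; rewrite !cats0.
have [zp zq] : z \notin p /\ z \notin q.
  move: u; rewrite cat_uniq /= negb_or => /and3P[_ /andP[-> _] /andP[-> _]] //.
rewrite -cat_rcons in u.
set b3 := flip (flip (flip b z) z) z.
have b3z : b3 z by rewrite /b3 /flip eqxx bq ?mem_head.
have b3x x : x != z -> b3 x = b x by rewrite /b3 /flip => /negPf->.
have [||b' b'T e] := IH (rcons p z) b3 u.
- move=> x; rewrite mem_rcons inE; case: (eqVneq x z) => [->//|xz /= xp].
  by rewrite b3x // bp.
- move=> x xq; have xz : x != z by apply: contraNneq zq => <-.
  by rewrite b3x // bq // inE xq orbT.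
exists b'; first by rewrite -cat_rcons.
have b1z : flip b z z by rewrite /flip eqxx bq ?mem_head.
have b2z : flip (flip b z) z z = false by rewrite {1}/flip eqxx b1z.
have -> : thrice (z :: q) ++ s = [:: z, z, z & thrice q ++ s] by [].
rewrite !mtf2_cost_cons (@mtf2_list_stay _ b) ?bq ?mem_head //.
rewrite mtf2_list_front // mtf2_list_stay // rev_cons -cats1 catA.
have zpq : z \notin rev p ++ rev q by rewrite mem_cat !mem_rev negb_or zp.
rewrite index_pivot // rem_cat_self // cats0 -/b3 -cat_rcons.
move: e; rewrite rev_rcons /= => ->.
by rewrite eqxx !size_cat !size_rev size_rcons /=; lia.
Qed.

Definition period (e : seq nat) : seq nat := e ++ thrice e.

Fixpoint rounds (n : nat) (e : seq nat) : seq nat :=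
  if n is n'.+1 then period e ++ rounds n' (rev e) else [::].

(** With [l = size e], twice the cost of a period is [l * (l + 1) + 2 * l * (2 * l + 1)]. *)
Lemma mtf2_rounds (n : nat) (e : seq nat) (b : nat -> bool) :
  uniq e -> {in e, forall x, b x} ->
  2 * mtf2_cost e b (rounds n e) = n * (size e * (5 * size e + 3)).
Proof.
elim: n e b => [|n IH] e b u be; first by rewrite muln0.
have [//|b1 b1F e1] := @mtf2_pass_once e [::] b (thrice e ++ rounds n (rev e)) u _ be.
have [//|b2 b2T e2] := @mtf2_pass_thrice e [::] b1 (rounds n (rev e)) u _ b1F.
rewrite /= -catA; move: e1 e2 => /= -> ->.
rewrite !mulnDr IH ?rev_uniq //; last by move=> x; rewrite mem_rev; exact: b2T.
by rewrite double_sumn_iota size_rev; nia.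
Qed.

(** * Offline schedules for the periodic requests *)

Definition off_le (O s : seq nat) (m : nat) : Prop :=
  exists sched, off_cost O sched s <= m.

Lemma off_le_front (O s : seq nat) (z m : nat) :
  off_le (z :: rem z O) s m -> off_le O (z :: s) ((index z O).+1 + m).
Proof.
case=> sched h; exists (([::], 0) :: sched).
by rewrite /= move_front add0n leq_add2l.
Qed.

Lemma off_le_stay (O s : seq nat) (z m : nat) : z \in O ->
  off_le O s m -> off_le O (z :: s) ((index z O).+1 + m).
Proof.
(* Taking the current position as the target leaves the list unchanged. *)
move=> zO [sched h]; exists (([::], index z O) :: sched).
rewrite /= add0n leq_add2l /move_forward minnn.
have [p [r [eO zp]]] := split_first zO.
by rewrite eO rem_cat_self // index_pivot // take_size_cat // drop_size_cat // -eO.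
Qed.

Lemma off_le_stays (q O s : seq nat) (m : nat) : {subset q <= O} ->
  off_le O s m -> off_le O (q ++ s) (size q * size O + m).
Proof.
elim: q => [//|z q IH] qO h.
have zO : z \in O by rewrite qO ?mem_head.
have [|sched le] := off_le_stay zO (IH _ h).
  by move=> x xq; rewrite qO // inE xq orbT.
exists sched; apply: leq_trans le _ => /=.
by move: zO; rewrite -index_mem /=; lia.
Qed.

Lemma off_le_pass_stay (q p s : seq nat) (m : nat) : uniq (p ++ q) ->
  off_le (p ++ q) s m ->
  off_le (p ++ q) (q ++ s) (sumn (iota (size p).+1 (size q)) + m).
Proof.
elim: q p => [//|z q IH] p u h.
have zp : z \notin p.
  by move: u; rewrite cat_uniq /= negb_or => /and3P[_ /andP[-> _] _].
have := IH (rcons p z); rewrite cat_rcons size_rcons => /(_ u h) h'.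
have zpq : z \in p ++ z :: q by rewrite mem_cat mem_head orbT.
by have := off_le_stay zpq h'; rewrite index_pivot // addnA.
Qed.

Lemma off_le_pass_front (q p s : seq nat) (m : nat) : uniq (p ++ q) ->
  off_le (rev (p ++ q)) s m ->
  off_le (rev p ++ q) (thrice q ++ s)
    (sumn (iota (size p).+1 (size q)) + 2 * size q + m).
Proof.
elim: q p m => [|z q IH] p m u h; first by move: h; rewrite !cats0.
have zp : z \notin p.
  by move: u; rewrite cat_uniq /= negb_or => /and3P[_ /andP[-> _] _].
have := IH (rcons p z) m; rewrite cat_rcons size_rcons rev_rcons => /(_ u h) h'.
(* The three requests are prepended from last to first. By [rz], moving [z] to the front when it is
   already there changes nothing, which covers the last two. *)
have rz : rem z (z :: rev p ++ q) = rev p ++ q by rewrite /= eqxx.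
rewrite /thrice /= -/(thrice q).
rewrite /= -{1}rz in h'; have := off_le_front h'.
rewrite -{1}rz; move/off_le_front.
rewrite -{1}[rev p ++ q](@rem_cat_self _ _ z) ?mem_rev //.
move/off_le_front; rewrite index_pivot ?mem_rev // size_rev /= eqxx.
by congr off_le; lia.
Qed.

(** With [l = size e], each pass costs [l * (l + 1) / 2], and the repeated requests of the second
    pass add [2 * l]. *)
Lemma off_le_rounds (n : nat) (e : seq nat) : uniq e ->
  off_le e (rounds n e) (n * (size e * (size e + 3))).
Proof.
elim: n e => [|n IH] e u; first by exists [::].
rewrite /= -catA.
have h : off_le (rev e) (rounds n (rev e)) (n * (size e * (size e + 3))).
  by have := IH (rev e); rewrite rev_uniq size_rev; apply.
have h1 := @off_le_pass_front e [::] _ _ u h.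
have := @off_le_pass_stay e [::] _ _ u h1.
by congr off_le; have := double_sumn_iota 0 (size e); rewrite /=; nia.
Qed.

(** * Arbitrary initial bits, and the exact ratio *)

Lemma mtf2_set_bits (q L s : seq nat) (b : nat -> bool) : uniq q ->
  {in q, forall x, b x = false} ->
  exists2 b' : nat -> bool, (forall x, b' x = (x \in q) || b x) &
    mtf2_cost L b' s <= mtf2_cost L b (q ++ s).
Proof.
elim: q b => [|z q IH] b; first by exists b.
move=> /andP[zq u] bF; have bz : b z = false by rewrite bF ?mem_head.
have [x xq|b' e le] := IH (flip b z) u.
  rewrite /flip; case: eqP xq zq => [-> ->//|_ xq _].
  by rewrite bF // inE xq orbT.
exists b' => [x|]; first by rewrite e inE /flip bz; case: eqP => // _; rewrite orbT.
by rewrite cat_cons mtf2_cost_cons mtf2_list_stay // (leq_trans le (leq_addl _ _)).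
Qed.

Lemma mtf2_lower (n l : nat) (L : seq nat) (b : nat -> bool) :
  perm_eq L (iota 0 l) ->
  exists s, [/\ all (fun x => x < l) s,
    n * (l * (5 * l + 3)) <= 2 * mtf2_cost L b s &
    OPT L s <= l * l + n * (l * (l + 3))].
Proof.
move=> pL; have uL : uniq L by rewrite (perm_uniq pL) iota_uniq.
have sL : size L = l by rewrite (perm_size pL) size_iota.
pose q := [seq x <- L | ~~ b x].
have qL : {subset q <= L} by move=> x; rewrite mem_filter => /andP[].
have bq : {in q, forall x, b x = false} by move=> x; rewrite mem_filter => /andP[/negPf].
exists (q ++ rounds n L); split.
- have rL m e : {subset rounds m e <= e}.
    elim: m e => //= m IH e x; rewrite !mem_cat => /orP[/orP[//|]|/IH]; last by rewrite mem_rev.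
    by case/flattenP=> t /mapP[z ze ->]; rewrite !inE !orbb => /eqP->.
  apply/allP=> x; rewrite mem_cat => xs.
  suff : x \in L by rewrite (perm_mem pL) mem_iota.
  by case/orP: xs => [/qL|/rL].
- have [|b' b'E le] := mtf2_set_bits L (rounds n L) _ bq; first exact: filter_uniq.
  rewrite -sL -(@mtf2_rounds n L b') ?leq_mul // => x xL.
  by rewrite b'E mem_filter xL andbT orNb.
(* The prefix has at most [l] requests of cost at most [l], a bound independent of [n]. *)
have [sched le] := off_le_stays qL (off_le_rounds n uL).
apply: leq_trans (OPT_le _ _ sched) (leq_trans le _).
by rewrite sL leq_add2r leq_mul2r size_filter -{2}sL count_size orbT.
Qed.

Lemma mtf2_competitive_5_2 (beta : nat -> seq nat -> nat -> bool) :
  mtf2_competitive beta (5 / 2)%R.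
Proof.
(* The initial potential is at most [5 * l * l], and the amortized bound carries a factor 4. *)
move=> l; exists (5 / 4 * INR (l * l))%R => L s pL sl.
have [sched eO] := OPT_achieved L s.
have := mtf2_cost_le_off_cost (beta l L) sched pL pL sl; rewrite eO => le.
have {le}/leP/le_INR : 4 * mtf2_cost L (beta l L) s <= 10 * OPT L s + 5 * (l * l).
  by apply: leq_trans le _; rewrite leq_add2l mulnA Psi_le.
rewrite -plusE -multE !plus_INR !mult_INR /=; lra.
Qed.

Theorem theorem7 (beta : nat -> seq nat -> nat -> bool) :
  (* 5/2 is the infimum (greatest lower bound) of the competitive constants *)
  (forall c : R, mtf2_competitive beta c -> (5 / 2 <= c)%R) /\
  (forall d : R, (forall c : R, mtf2_competitive beta c -> (d <= c)%R) ->
     (d <= 5 / 2)%R).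
Proof.
split=> [c0 cc|d]; last by apply; exact: mtf2_competitive_5_2.
(* Nonnegativity of [c] allows the upper bound on OPT to be multiplied by it. *)
apply: Rnot_lt_le => c0lt; pose c := Rmax c0 0.
have c_ge0 : (0 <= c)%R by exact: Rmax_r.
have c_lt : (c < 5 / 2)%R by apply: Rmax_lub_lt => //; lra.
have gap_gt0 : (0 < 5 - 2 * c)%R by lra.
(* This length makes [5 * l + 3] exceed [2 * c * (l + 3)]; the successor ensures [l > 0]. *)
have [l0 l0P] := INR_unbounded (6 * c / (5 - 2 * c)).
have {l0P} : (6 * c < INR l0.+1 * (5 - 2 * c))%R.
  move: l0P => /(Rmult_lt_compat_r _ _ _ gap_gt0).
  rewrite S_INR /Rdiv Rmult_assoc Rinv_l; lra.
move: {l0}(l0.+1) (leP (ltn0Sn l0)) => l /lt_INR /= l_gt0 lP.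
have [b0 H] := cc l; pose K := (INR l * INR l)%R.
have {H} H n : (INR n * (INR l * (5 * INR l + 3)) <=
    2 * (c * (K + INR n * (INR l * (INR l + 3))) + b0))%R.
  have [s [sl lo hi]] := @mtf2_lower n l (iota 0 l) (beta l (iota 0 l)) (perm_refl _).
  have := H _ s (perm_refl _) sl; move/leP/le_INR: lo; move/leP/le_INR: hi.
  rewrite -plusE -multE !(plus_INR, mult_INR) /=.
  set x := INR (OPT _ _) => hi lo up.
  have x0 : (0 <= x)%R by exact: pos_INR.
  have : (c0 * x <= c * x)%R by apply: Rmult_le_compat_r => //; exact: Rmax_l.
  have := Rmult_le_compat_l _ _ _ c_ge0 hi.
  rewrite /K; lra.
(* Every period adds [A > 0] to the excess of twice the MTF2 cost over [2 * c] times the offline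
   cost, while [H] bounds [n * A] for all [n]. *)
pose A := (INR l * (5 * INR l + 3 - 2 * c * (INR l + 3)))%R.
have A_gt0 : (0 < A)%R by apply: Rmult_lt_0_compat => //; nra.
have [n nP] := INR_unbounded (2 * (c * K + b0) / A).
have := H n; have := Rmult_lt_compat_r _ _ _ A_gt0 nP.
rewrite {1}/Rdiv Rmult_assoc Rinv_l; last by lra.
by rewrite /A; lra.
Qed.
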